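(* Let $n \ge 2$ and let $P$ be an instance of the stable matching problem with $n$ men and $n$ women. Then the man-proposing accelerated deferred acceptance (ADA) algorithm run on $P$ returns the same matching as the man-proposing deferred acceptance (DA) algorithm run on $P$.
   Context: Instance. $M$ is a set of $n$ men and $W$ is a set of $n$ women, $n \ge 2$. An instance $P$ of the stable matching problem consists of, for each man $m \in M$, a strict preference relation (strict linear order) $\succ_m$ on all of $W$, and, for each woman $w \in W$, a strict preference relation (strict linear order) $\succ_w$ on all of $M$. A matching is a bijective pairing of $M$ with $W$, i.e. a map $\mu : M \cup W \to M \cup W$ with $\mu(m) \in W$ for $m \in M$, $\mu(w) \in M$ for $w \in W$, and $\mu(m) = w$ if and only if $\mu(w) = m$. The two (man-proposing) algorithms. Both proceed in rounds $1, 2, 3, \dots$. Initially all men are single, no woman has rejected any man, and no one is matched. Each round has three steps: 1. Each man who is single at the start of the round proposes to his most preferred woman among those who have not yet rejected him. 2. Each woman $w$ who holds at least one proposal tentatively accepts her most preferred proposer $m^*$ (with respect to $\succ_w$). Here the proposers of $w$ in a round are the men who propose to her in that round together with the man, if any, with whom she was tentatively matched at the end of the previous round. Then: - in DA, $w$ rejects all of her proposers that she ranks below $m^*$; - in ADA, $w$ rejects all men in $M$ that she ranks below $m^*$, whether or not they have proposed to her. Rejections are permanent. 3. The man accepted by $w$ is tentatively matched with $w$; every man who is not tentatively matched at the end of the round is single for the next round. The algorithm terminates at the end of the first round after which no man is single, and it returns the current set of tentatively matched pairs. ''Returns a matching'' means that the algorithm terminates after finitely many rounds and its output is that matching. *)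

(* Defs.v *)
From mathcomp Require Import all_boot.

Set Implicit Arguments.
Unset Strict Implicit.
Unset Printing Implicit Defensive.

Definition strict_linear_order (T : eqType) (r : rel T) : Prop :=
  [/\ irreflexive r, transitive r & forall x y, x != y -> r x y || r y x].

(* [prefM P m w w'] : m prefers w to w'; [prefW P w m m'] : w prefers m to m'. *)
Record instance (M W : finType) := Instance {
  prefM : M -> rel W;
  prefW : W -> rel M;
  prefM_slo : forall m, strict_linear_order (prefM m);
  prefW_slo : forall w, strict_linear_order (prefW w) }.

Definition is_matching (M W : finType) (mu : M + W -> M + W) : Prop :=
  [/\ forall m : M, exists w : W, mu (inl m) = inr w,
      forall w : W, exists m : M, mu (inr w) = inl m &
      forall (m : M) (w : W), mu (inl m) = inr w <-> mu (inr w) = inl m].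

Definition matching_pairs (M W : finType) (mu : M + W -> M + W) : {set M * W} :=
  [set p | mu (inl p.1) == inr p.2].

Variant algorithm := DA | ADA.

(* [(m, w) \in rejected s] : w has rejected m;
   [(m, w) \in matched s] : m and w are tentatively matched. *)
Record state (M W : finType) := State {
  rejected : {set M * W};
  matched : {set M * W} }.

Section Round.

Variables (M W : finType) (P : instance M W).
Implicit Types (s : state M W) (m : M) (w : W).

Definition single s m : bool := [forall w, (m, w) \notin matched s].

Definition proposes s m w : bool :=
  [&& single s m, (m, w) \notin rejected s &
      [forall w', (w' != w) && ((m, w') \notin rejected s) ==> prefM P m w w']].

(* The state [s] is the one at the start of the round, so [matched s] records
   the tentative matches at the end of the previous round. *)
Definition proposer s w m : bool := proposes s m w || ((m, w) \in matched s).

Definition accepts s w m : bool :=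
  proposer s w m &&
  [forall m', (m' != m) && proposer s w m' ==> prefW P w m m'].

Definition rejects (a : algorithm) s w m : bool :=
  [exists m0, accepts s w m0 && prefW P w m0 m] &&
  match a with DA => proposer s w m | ADA => true end.

Definition round (a : algorithm) s : state M W :=
  State (rejected s :|: [set p | rejects a s p.2 p.1])
        [set p | accepts s p.2 p.1].

Definition init_state : state M W := State set0 set0.

Definition after_round (a : algorithm) (t : nat) : state M W :=
  iter t (round a) init_state.

Definition no_man_single s : bool := [forall m, ~~ single s m].

Definition terminates_at (a : algorithm) (t : nat) : Prop :=
  [/\ 0 < t, no_man_single (after_round a t) &
      forall k, 0 < k < t -> ~~ no_man_single (after_round a k)].

Definition returns (a : algorithm) (mu : M + W -> M + W) : Prop :=
  is_matching mu /\
  exists t, terminates_at a t /\ matched (after_round a t) = matching_pairs mu.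

End Round.

(* Main.v *)
(** Both algorithms return the man-optimal stable matching.  In either run a
    woman who has rejected a man always holds someone she prefers to him, a man
    has been rejected by every woman he prefers to the one he holds, and no
    rejected pair belongs to a stable matching.  Hence the final matching is
    stable, and every man gets in it his best stable partner. *)
Require Import Defs.
From mathcomp Require Import all_boot.

Set Implicit Arguments.
Unset Strict Implicit.
Unset Printing Implicit Defensive.

(** * Best elements in finite strict linear orders *)

Section StrictLinearOrder.

Variables (T : finType) (r : rel T).
Hypothesis rP : strict_linear_order r.

Lemma slo_asym x y : r x y -> r y x -> False.
Proof. by case: rP => irr tr _ xy /(tr _ _ _ xy); rewrite irr. Qed.

(** An element of [A] with the fewest elements of [A] above it works: if [y] were above it, then [y]
    would have strictly fewer, by transitivity and irreflexivity. *)
Lemma slo_best (A : pred T) x0 : A x0 ->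
  exists2 x, A x & forall y, y != x -> A y -> r x y.
Proof.
have [irr tr tot] := rP.
move=> Ax0; pose f x := #|[set y | A y && r y x]|.
case: (@arg_minnP T x0 A f Ax0) => x Ax xmin; exists x => // y yx Ay.
have /orP[ryx|//] := tot _ _ yx.
have : f y < f x; last by rewrite ltnNge xmin.
apply/proper_card/properP; split.
  by apply/subsetP => z; rewrite !inE => /andP[-> /tr ->].
by exists y; rewrite !inE Ay ?ryx ?irr.
Qed.

End StrictLinearOrder.

(** * Stable matchings and the invariant of the rounds *)

Section DeferredAcceptance.

Variables (M W : finType) (P : instance M W).
Implicit Types (s : state M W) (S : {set M * W}) (m : M) (w : W).

Record stable S : Prop := Stable {
  stable_total : forall m, exists w, (m, w) \in S;
  stable_uniqM : forall m w w', (m, w) \in S -> (m, w') \in S -> w = w';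
  stable_uniqW : forall m m' w, (m, w) \in S -> (m', w) \in S -> m = m';
  stable_unblocked : forall m w m' w', (m, w) \in S -> (m', w') \in S ->
    prefM P m w' w -> prefW P w' m m' -> False }.

(** No clause mentions the algorithm, so one induction serves both runs and their states can be
    compared directly. *)
Record invariant s : Prop := Invariant {
  inv_uniqM : forall m w w',
    (m, w) \in matched s -> (m, w') \in matched s -> w = w';
  inv_uniqW : forall m m' w,
    (m, w) \in matched s -> (m', w) \in matched s -> m = m';
  inv_better : forall m w w',
    (m, w) \in matched s -> prefM P m w' w -> (m, w') \in rejected s;
  inv_rejected : forall m w, (m, w) \in rejected s ->
    exists2 m0, (m0, w) \in matched s & prefW P w m0 m;
  inv_stable : forall S m w,
    stable S -> (m, w) \in rejected s -> (m, w) \notin S }.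

Lemma proposesP s m w : proposes P s m w ->
  [/\ forall w', (m, w') \notin matched s, (m, w) \notin rejected s &
    forall w', w' != w -> (m, w') \notin rejected s -> prefM P m w w'].
Proof.
case/and3P => /forallP sgl nrej /forallP best; split=> // w' ne nrej'.
by have /implyP := best w'; rewrite ne nrej'; apply.
Qed.

Lemma acceptsP s w m : accepts P s w m ->
  proposer P s w m /\
  forall m', m' != m -> proposer P s w m' -> prefW P w m m'.
Proof.
case/andP => pm /forallP best; split=> // m' ne pm'.
by have /implyP := best m'; rewrite ne pm'; apply.
Qed.

Lemma accepts_exists s w m : proposer P s w m -> exists m0, accepts P s w m0.
Proof.
case/(slo_best (prefW_slo P w)) => m0 pm0 best.
exists m0; rewrite /accepts pm0; apply/forallP => m'.
by apply/implyP => /andP[]; apply: best.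
Qed.

Lemma accepts_uniq s w m m' : accepts P s w m -> accepts P s w m' -> m = m'.
Proof.
move=> /acceptsP[pm best] /acceptsP[pm' best'].
have [//|ne] := eqVneq m m'.
have ne' : m' != m by rewrite eq_sym.
by case: (slo_asym (prefW_slo P w) (best _ ne' pm') (best' _ ne pm)).
Qed.

Lemma proposes_uniq s m w w' : proposes P s m w -> proposes P s m w' -> w = w'.
Proof.
move=> /proposesP[_ nr best] /proposesP[_ nr' best'].
have [//|ne] := eqVneq w w'.
have ne' : w' != w by rewrite eq_sym.
by case: (slo_asym (prefM_slo P m) (best _ ne' nr') (best' _ ne nr)).
Qed.

(** A new proposal goes to the best woman who has not rejected [m]; for a man already held this is
    [inv_better]. *)
Lemma proposer_better s m w w' : invariant s -> proposer P s w m ->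
  prefM P m w' w -> (m, w') \in rejected s.
Proof.
move=> inv /orP[/proposesP[_ _ best]|mw]; last exact: (inv_better inv mw).
move=> pref; apply/negPn/negP => nr.
have [eq|ne] := eqVneq w' w.
  by subst w'; case: (slo_asym (prefM_slo P m) pref pref).
exact: (slo_asym (prefM_slo P m) pref (best _ ne nr)).
Qed.

Lemma mem_matched_round a s m w :
  ((m, w) \in matched (round P a s)) = accepts P s w m.
Proof. by rewrite inE. Qed.

Lemma mem_rejected_round a s m w :
  ((m, w) \in rejected (round P a s)) =
  ((m, w) \in rejected s) || rejects P a s w m.
Proof. by rewrite !inE. Qed.

Lemma invariant_init : invariant (init_state M W).
Proof. by split=> [m w w'|m m' w|m w w'|m w|S m w _]; rewrite inE. Qed.

Lemma invariant_round a s : invariant s -> invariant (round P a s).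
Proof.
move=> inv; split.
- move=> m w w'; rewrite !mem_matched_round.
  move=> /acceptsP[/orP[pw|mw] _] /acceptsP[/orP[pw'|mw'] _].
  + exact: proposes_uniq pw pw'.
  + by case/proposesP: pw => /(_ w'); rewrite mw'.
  + by case/proposesP: pw' => /(_ w); rewrite mw.
  + exact: (inv_uniqM inv mw mw').
- by move=> m m' w; rewrite !mem_matched_round; apply: accepts_uniq.
- move=> m w w'; rewrite mem_matched_round mem_rejected_round.
  by move=> /acceptsP[pm _] /(proposer_better inv pm) ->.
- move=> m w; rewrite mem_rejected_round => /orP[/(inv_rejected inv)|].
    case=> m0 m0w pref.
    (* The man she holds competes again, so her next choice is [m0] or someone better. *)
    have pm0 : proposer P s w m0 by rewrite /proposer m0w orbT.
    have [m1 acc] := accepts_exists pm0.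
    exists m1; first by rewrite mem_matched_round.
    have [<-//|ne] := eqVneq m0 m1.
    have [_ /(_ _ ne pm0) pref'] := acceptsP acc.
    by case: (prefW_slo P w) => _ tr _; apply: tr pref.
  (* Only the part of [rejects] common to DA and ADA is kept: she accepts someone she prefers to
     [m]. *)
  case/andP => /existsP[m0 /andP[acc pref]] _.
  by exists m0; rewrite ?mem_matched_round.
- move=> S m w stS; rewrite mem_rejected_round.
  case/orP => [/(inv_stable inv stS)//|].
  case/andP => /existsP[m0 /andP[/acceptsP[pm0 _] pref]] _.
  (* Otherwise [m0], whom [w] prefers to [m], forms a blocking pair with her. *)
  apply/negP => mwS.
  have [w0 m0w0] := stable_total stS m0.
  have [eqw|ne] := eqVneq w w0.
    subst w0; rewrite (stable_uniqW stS mwS m0w0) in pref.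
    exact: (slo_asym (prefW_slo P w) pref pref).
  have [_ _ /(_ _ _ ne)/orP[prefm|prefm]] := prefM_slo P m0.
    exact: (stable_unblocked stS m0w0 mwS prefm pref).
  (* Here [m0] prefers [w0] to [w], so [w0] has already rejected him, although they are paired in
     [S]. *)
  have /(inv_stable inv stS) := proposer_better inv pm0 prefm.
  by rewrite m0w0.
Qed.

Lemma invariant_after_round a t : invariant (after_round P a t).
Proof.
by elim: t => [|t IHt]; [exact: invariant_init | exact: invariant_round].
Qed.

(** * Termination, by growth of the set of settled pairs *)

Definition settled s := rejected s :|: matched s.

Lemma proposer_settled a s w m :
  proposer P s w m -> (m, w) \in settled (round P a s).
Proof.
move=> pm; rewrite inE mem_rejected_round mem_matched_round.
have [m0 acc] := accepts_exists pm.
have [->|ne] := eqVneq m m0; first by rewrite acc orbT.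
(* The extra condition of DA, that [m] be a proposer, is the hypothesis [pm]. *)
apply/orP; left; apply/orP; right; apply/andP; split; last by case: (a).
apply/existsP; exists m0; rewrite acc /=.
by have [_] := acceptsP acc; apply.
Qed.

Hypothesis cardMW : #|M| = #|W|.

(* A man rejected by all women would find them all holding other men, but there
   are only [#|W| - 1] of those. *)
Lemma single_unrejected s m : invariant s -> single s m ->
  exists w, (m, w) \notin rejected s.
Proof.
move=> inv /forallP sgl; apply/existsP; rewrite -negb_forall; apply/negP.
move=> /forallP rej.
pose g w := odflt m [pick m0 | (m0, w) \in matched s].
have gP w : (g w, w) \in matched s.
  rewrite /g; case: pickP => //= none.
  by have [m0] := inv_rejected inv (rej w); rewrite (none m0).
have g_inj : injective g.
  by move=> w w' eq; apply: (inv_uniqM inv (m := g w)); rewrite ?gP // eq gP.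
have /codomP[w mE] : m \in codom g by apply: inj_card_onto; rewrite ?cardMW.
by have := sgl w; rewrite {1}mE gP.
Qed.

Lemma single_proposes s m : invariant s -> single s m ->
  exists w, proposes P s m w.
Proof.
move=> inv sgl; have [w0 nr0] := single_unrejected inv sgl.
have [w nr best] :=
  slo_best (prefM_slo P m) (A := [pred w | (m, w) \notin rejected s]) nr0.
exists w; apply/and3P; split=> //; apply/forallP => w'.
by apply/implyP => /andP[]; apply: best.
Qed.

(** A single man's new proposal settles a fresh pair, while a held man remains a proposer and so
    stays settled. Rejections alone would not do as a measure: a round of DA may produce none. *)
Lemma settled_proper a s : invariant s -> ~~ no_man_single s ->
  settled s \proper settled (round P a s).
Proof.
move=> inv; rewrite negb_forall => /existsP[m /negPn sgl].
have [w pw] := single_proposes inv sgl.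
apply/properP; split.
  apply/subsetP => -[m' w']; rewrite inE => /orP[rej|mw].
    by rewrite inE mem_rejected_round rej.
  by apply: proposer_settled; rewrite /proposer mw orbT.
exists (m, w); first by apply: proposer_settled; rewrite /proposer pw.
by have [nm nr _] := proposesP pw; rewrite inE negb_or nr nm.
Qed.

Lemma no_man_single_eventually a : exists t, no_man_single (after_round P a t).
Proof.
pose N := #|{: M * W}|.
have [/existsP[t ?]|none] :=
  boolP [exists t : 'I_N.+1, no_man_single (after_round P a t)].
  by exists t.
(* At [t = N.+1] this would give more settled pairs than there are pairs. *)
have grows t : t <= N.+1 -> t <= #|settled (after_round P a t)|.
  elim: t => // t IHt lt_t; apply: leq_ltn_trans (IHt (ltnW lt_t)) _.
  apply/proper_card/settled_proper; first exact: invariant_after_round.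
  by move: none; rewrite negb_exists => /forallP/(_ (Ordinal lt_t)).
by have := leq_trans (grows _ (leqnn _)) (max_card _); rewrite ltnn.
Qed.

Lemma terminates a : 0 < #|M| -> exists t, terminates_at P a t.
Proof.
case/card_gt0P => m _.
have ex : exists t, (0 < t) && no_man_single (after_round P a t).
  have [[|t] nos] := no_man_single_eventually a; last by exists t.+1.
  (* Round 0 is excluded: [m] is single in the initial state. *)
  by have /forallP/(_ m)/forallP[] := nos; move=> w; rewrite inE.
case: (ex_minnP ex) => t /andP[t0 nos] tmin.
exists t; split=> // k /andP[k0 kt]; apply/negP => nosk.
by have := tmin k; rewrite k0 nosk => /(_ isT); rewrite leqNgt kt.
Qed.

(** * Stability and man-optimality of the outcome *)

Lemma stable_matched s : invariant s -> no_man_single s -> stable (matched s).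
Proof.
move=> inv /forallP nos; split; last 1 first.
- move=> m w m' w' mw m'w' prefm prefw.
  (* As [m] prefers [w'], she has rejected him and holds someone better, who can only be [m']. *)
  have [m0 m0w' prefw0] :=
    inv_rejected inv (inv_better inv mw prefm).
  rewrite (inv_uniqW inv m0w' m'w') in prefw0.
  exact: (slo_asym (prefW_slo P w') prefw prefw0).
- move=> m; have := nos m; rewrite negb_forall => /existsP[w /negPn mw].
  by exists w.
- exact: inv_uniqM.
- exact: inv_uniqW.
Qed.

(** Every woman [m] prefers to [w] has rejected him, and no rejected pair lies in a stable [S]. *)
Lemma man_optimal s S m w w' : invariant s -> stable S ->
  (m, w) \in matched s -> (m, w') \in S -> w != w' -> prefM P m w w'.
Proof.
move=> inv stS mw mw' ne.
have [_ _ /(_ _ _ ne)/orP[//|pref]] := prefM_slo P m.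
have /(inv_stable inv stS) := inv_better inv mw pref.
by rewrite mw'.
Qed.

(** Both matchings are stable, so [man_optimal] applies in both directions; a man with two different
    partners would prefer each to the other. *)
Lemma matched_sub s s' : invariant s -> invariant s' ->
  no_man_single s -> no_man_single s' -> matched s \subset matched s'.
Proof.
move=> inv inv' nos nos'.
have st := stable_matched inv nos; have st' := stable_matched inv' nos'.
apply/subsetP => -[m w] mw; have [w' mw'] := stable_total st' m.
have [->//|ne] := eqVneq w w'.
have pref := man_optimal inv st' mw mw' ne.
rewrite eq_sym in ne.
have pref' := man_optimal inv' st mw' mw ne.
by case: (slo_asym (prefM_slo P m) pref pref').
Qed.

(** * From stable sets of pairs to matchings as maps *)

Definition partner S (x : M + W) : M + W :=
  match x with
  | inl m => oapp inr x [pick w | (m, w) \in S]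
  | inr w => oapp inl x [pick m | (m, w) \in S]
  end.

Lemma partner_inl S m w : stable S ->
  partner S (inl m) = inr w <-> (m, w) \in S.
Proof.
(* The default value [inl m] is on the wrong side to equal [inr w], so with no partner both
   statements are false. *)
move=> st /=; case: pickP => [w0 mw0|none] /=; last by rewrite none.
by split=> [[<-]//|mw]; congr inr; apply: (stable_uniqM st mw0 mw).
Qed.

Lemma partner_inr S m w : stable S ->
  partner S (inr w) = inl m <-> (m, w) \in S.
Proof.
move=> st /=; case: pickP => [m0 mw0|none] /=; last by rewrite none.
by split=> [[<-]//|mw]; congr inl; apply: (stable_uniqW st mw0 mw).
Qed.

(** Sending each man to his partner is injective, hence onto by [cardMW]; this is why [stable] asks
    for totality on the men's side only. *)
Lemma stable_totalW S w : stable S -> exists m, (m, w) \in S.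
Proof.
move=> st; pose g m := odflt w [pick w' | (m, w') \in S].
have gP m : (m, g m) \in S.
  rewrite /g; case: pickP => //= none.
  by have [w0] := stable_total st m; rewrite (none w0).
have g_inj : injective g.
  by move=> m m' eq; apply: (stable_uniqW st (w := g m)); rewrite ?gP // eq gP.
have /codomP[m ->] : w \in codom g by apply: inj_card_onto; rewrite ?cardMW.
by exists m.
Qed.

Lemma partner_matching S : stable S -> is_matching (partner S).
Proof.
move=> st; split=> [m|w|m w].
- by have [w mw] := stable_total st m; exists w; apply/partner_inl.
- by have [m mw] := stable_totalW w st; exists m; apply/partner_inr.
- exact: (iff_trans (partner_inl m w st) (iff_sym (partner_inr m w st))).
Qed.

Lemma matching_pairs_partner S : stable S -> matching_pairs (partner S) = S.
Proof.
move=> st; apply/setP => -[m w]; rewrite inE.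
by apply/eqP/idP => /partner_inl; apply.
Qed.

End DeferredAcceptance.

Theorem theorem1 (n : nat) (M W : finType) (n_ge2 : 2 <= n)
    (cardM : #|M| = n) (cardW : #|W| = n) (P : instance M W) :
  exists mu : M + W -> M + W, returns P DA mu /\ returns P ADA mu.
Proof.
have cardMW : #|M| = #|W| by rewrite cardM cardW.
have M_gt0 : 0 < #|M| by rewrite cardM ltnW.
have [t term] := terminates P cardMW DA M_gt0.
have [t' term'] := terminates P cardMW ADA M_gt0.
have [_ nos _] := term; have [_ nos' _] := term'.
have inv := invariant_after_round P DA t.
have inv' := invariant_after_round P ADA t'.
have st := stable_matched inv nos.
have eq : matched (after_round P ADA t') = matched (after_round P DA t).
  by apply/eqP; rewrite eqEsubset !(matched_sub (P := P)).
have mat := partner_matching cardMW st.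
(* The map built from the outcome of DA also serves ADA, through [eq]. *)
exists (partner (matched (after_round P DA t))).
by split; split=> //; [exists t | exists t']; split;
  rewrite // (matching_pairs_partner st).
Qed.
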